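(* Suppose that every bridgeless graph $G$ admits five cycles (even subgraphs) such that every edge of $G$ belongs to exactly two of them (the $5$-Cycle Double Cover Conjecture). Then every bridgeless cubic graph $G$ satisfies $T(G)\leq \frac{2}{5}|V(G)|$.
   Context: Graphs are finite and loopless but may have parallel edges. A cubic graph is one in which every vertex has degree $3$. Here the ''cycles'' in a cycle double cover are edge sets of subgraphs in which every vertex has even degree (possibly empty). For a cubic graph $G$ and $U\subseteq V(G)$, $G_U$ denotes the cubic graph obtained from $G$ by expanding every vertex of $U$ into a triangle: a vertex $v$ with incident edges $e_1,e_2,e_3$ is replaced by three new mutually adjacent vertices $v_1,v_2,v_3$, with $e_i$ now incident to $v_i$ instead of $v$. For a bridgeless cubic graph $G$, $T(G)$ is the minimum size of a set $U\subseteq V(G)$ such that the edge set of $G_U$ is the union of four (not necessarily distinct) perfect matchings of $G_U$. *)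

(* Defs.v *)
From mathcomp Require Import all_boot.

Set Implicit Arguments.
Unset Strict Implicit.
Unset Printing Implicit Defensive.

(* Finite loopless multigraph: edges form a type of their own, so parallel
   edges are distinct edges with the same pair of ends. *)
Record mgraph := MGraph {
  vertex : finType;
  edge : finType;
  ends : edge -> {set vertex};
  card_ends : forall e, #|ends e| = 2 }.

Definition incident_edges (G : mgraph) (v : vertex G) : {set edge G} :=
  [set e | v \in ends e].

Definition cubic (G : mgraph) : Prop :=
  forall v : vertex G, #|incident_edges v| = 3.

Definition adj_without (G : mgraph) (e : edge G) : rel (vertex G) :=
  fun u v => [exists f, (f != e) && (ends f == [set u; v])].

(* A bridge is an edge that separates its ends. *)
Definition bridge (G : mgraph) (e : edge G) : Prop :=
  exists u v, ends e = [set u; v] /\ ~~ connect (adj_without e) u v.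

Definition bridgeless (G : mgraph) : Prop := forall e : edge G, ~ bridge e.

Definition even_subgraph (G : mgraph) (C : {set edge G}) : Prop :=
  forall v, ~~ odd #|incident_edges v :&: C|.

Definition has_5cdc (G : mgraph) : Prop :=
  exists C : 'I_5 -> {set edge G},
    (forall i, even_subgraph (C i)) /\
    (forall e, #|[set i | e \in C i]| = 2).

Definition perfect_matching (G : mgraph) (M : {set edge G}) : Prop :=
  forall v, #|incident_edges v :&: M| = 1.

Definition covered_by_4_perfect_matchings (G : mgraph) : Prop :=
  exists M : 'I_4 -> {set edge G},
    (forall i, perfect_matching (M i)) /\ \bigcup_i M i = [set: edge G].

Section Expansion.
Variables (G : mgraph) (U : {set vertex G}).

(* inl v is a vertex v outside U; inr (v, e), with v in U and e incident to v,
   is the new vertex replacing v that takes over the edge e. *)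
Definition exp_vertex : finType :=
  ({v : vertex G | v \notin U} +
   {ve : vertex G * edge G | (ve.1 \in U) && (ve.1 \in ends ve.2)})%type.

(* inl e is an original edge; inr (v, {e, f}), with v in U and e != f incident
   to v, is the new edge joining (v, e) and (v, f).  For v of degree 3 these
   are the three edges of the triangle replacing v. *)
Definition exp_edge : finType :=
  (edge G +
   {vP : vertex G * {set edge G} |
      [&& vP.1 \in U, vP.2 \subset incident_edges vP.1 & #|vP.2| == 2]})%type.

Definition exp_ends (a : exp_edge) : {set exp_vertex} :=
  match a with
  | inl e => [set x : exp_vertex |
      match x with
      | inl v => val v \in ends e
      | inr ve => ((val ve).1 \in ends e) && ((val ve).2 == e)
      end]
  | inr vP => [set x : exp_vertex |
      match x with
      | inl _ => false
      | inr ve => ((val ve).1 == (val vP).1) && ((val ve).2 \in (val vP).2)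
      end]
  end.

Lemma card_exp_ends a : #|exp_ends a| = 2.
Proof.
case: a => [e|[[v P] /= /and3P[vU sP /eqP P2]]].
  pose base (x : exp_vertex) :=
    match x with inl v => val v | inr ve => (val ve).1 end.
  rewrite -[RHS](card_ends e) -(card_in_imset (f := base)).
    apply: eq_card => v; apply/imsetP/idP => [[[w|w]]|ve].
    - by rewrite inE => ? ->.
    - by rewrite inE => /andP[? _] ->.
    - have [vU|vU] := boolP (v \in U).
        have p : ((v, e).1 \in U) && ((v, e).1 \in ends (v, e).2).
          by rewrite /= vU ve.
        by exists (inr (Sub (v, e) p)); rewrite // inE /= ve eqxx.
      by exists (inl (Sub v vU)); rewrite // inE.
  move=> [[x xU]|[[x f] xf]] [[y yU]|[[y g] yg]]; rewrite !inE /=.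
  - by move=> _ _ exy; congr inl; apply: val_inj.
  - by have /andP[/= yU _] := yg; move=> _ _ exy; case/negP: (xU); rewrite exy.
  - by have /andP[/= xU _] := xf; move=> _ _ exy; case/negP: (yU); rewrite -exy.
  - move=> /andP[_ /eqP ef] /andP[_ /eqP eg] exy.
    by congr inr; apply: val_inj; rewrite /= ef eg exy.
pose lab (x : exp_vertex) :=
  match x with inl _ => None | inr ve => Some (val ve).2 end.
rewrite -[RHS]P2 -(card_imset P (@Some_inj _)) -(card_in_imset (f := lab)).
  apply: eq_card => o; apply/imsetP/imsetP => [[[x|x]]|[f fP ->]].
  - by rewrite inE.
  - by rewrite inE => /andP[_ xP] ->; exists (val x).2.
  - have p : ((v, f).1 \in U) && ((v, f).1 \in ends (v, f).2).
      by have := subsetP sP f fP; rewrite /= vU inE.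
    by exists (inr (Sub (v, f) p)); rewrite // inE /= eqxx.
move=> [x|[[x f] xf]] [y|[[y g] yg]]; rewrite !inE //=.
move=> /andP[/eqP xv _] /andP[/eqP yv _] [fg].
by congr inr; apply: val_inj; rewrite /= xv yv fg.
Qed.

Definition expand : mgraph := MGraph card_exp_ends.

End Expansion.

(* T(G) = t.  Stated as a relation: that some U is admissible at all, so that
   the minimum exists, is part of any claim that is_T G t holds for some t. *)
Definition is_T (G : mgraph) (t : nat) : Prop :=
  (exists U : {set vertex G},
     covered_by_4_perfect_matchings (expand U) /\ #|U| = t) /\
  (forall U : {set vertex G},
     covered_by_4_perfect_matchings (expand U) -> t <= #|U|).

(* Main.v *)
Require Import Defs.
From HB Require Import structures.
From mathcomp Require Import all_boot all_order all_algebra.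
From mathcomp Require Import zify.
Local Open Scope ring_scope.

(** In a cubic graph, the members of a cycle double cover that pass through a
    vertex are three in number, each using two of its edges; so if there are
    five members, each vertex is missed by exactly two of them, and by averaging
    some member [C i0] misses a set [U] of at most two fifths of the vertices.
    Expanding [U] and running [C i0] around each new triangle makes it a
    2-factor. If [D] is the complementary perfect matching, the symmetric
    differences of [D] with the four other cycles (suitably rerouted through the
    triangles) are perfect matchings, and they cover every edge. *)

Local Open Scope nat_scope.

(** * Cycles of a double cover at a vertex of a cubic graph *)

Section CycleDoubleCover.
Variables (G : mgraph) (n : nat) (C : 'I_n -> {set edge G}).
Hypothesis G_cubic : cubic G.
Hypothesis C_even : forall i, even_subgraph (C i).
Hypothesis C_double : forall e, #|[set i | e \in C i]| = 2.

Implicit Types (v : vertex G) (e f g : edge G) (i j : 'I_n).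

Definition missed_vertices i : {set vertex G} :=
  [set v | incident_edges v :&: C i == set0].

(** The degree of a cycle at [v] is even and at most 3, hence 0 or 2. *)
Lemma card_incident_cycle v i :
  #|incident_edges v :&: C i| = (v \notin missed_vertices i).*2.
Proof.
rewrite inE -cards_eq0; have := C_even i v.
have : #|incident_edges v :&: C i| <= 3.
  by rewrite -(G_cubic v) subset_leq_card ?subsetIl.
by case: #|_| => [|[|[|[|]]]].
Qed.

Lemma incident_cycle_eq2 v i e :
  e \in incident_edges v -> e \in C i -> #|incident_edges v :&: C i| = 2.
Proof.
move=> ev ei; rewrite card_incident_cycle inE.
by case: eqP => // /setP/(_ e); rewrite in_setI ev ei in_set0.
Qed.

Lemma in3_cycles e i j k :
  e \in C i -> e \in C j -> e \in C k -> i != j -> i != k -> j != k -> False.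
Proof.
move=> ei ej ek ij ik jk.
have : [set i; j; k] \subset [set i | e \in C i].
  by apply/subsetP=> l; rewrite !inE => /orP[/orP[]|] /eqP->.
move=> /subset_leq_card; rewrite C_double -setUA cardsU1 cards2 !inE.
by rewrite (negPf ij) (negPf ik) jk.
Qed.

Lemma sum_missed_vertices : \sum_i #|missed_vertices i| + 3 * #|vertex G|
  = n * #|vertex G|.
Proof.
(* The pairs of a cycle and an edge of it at [v] number 6: two for each of the three edges, and also
   two for each cycle through [v]. *)
have count v : \sum_i (v \notin missed_vertices i) = 3.
  apply: double_inj; rewrite -muln2 big_distrl /=.
  transitivity (\sum_i \sum_(e in incident_edges v) (e \in C i)).
    apply: eq_bigr => i _; rewrite muln2 -card_incident_cycle -sum1_card.
    by rewrite big_mkcond [RHS]big_mkcond; apply: eq_bigr => e _;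
       rewrite in_setI; case: (_ \in incident_edges v); case: (_ \in C i).
  rewrite exchange_big /= (eq_bigr (fun=> 2)); last first.
    move=> e _; rewrite -(C_double e) -sum1_card [RHS]big_mkcond.
    by apply: eq_bigr => i _; rewrite inE; case: (_ \in _).
  by rewrite sum_nat_const (G_cubic v).
have -> : 3 * #|vertex G| = \sum_i \sum_v (v \notin missed_vertices i).
  by rewrite exchange_big (eq_bigr _ (fun v _ => count v)) sum_nat_const mulnC.
rewrite -big_split /= -[n in RHS]card_ord -sum_nat_const.
apply: eq_bigr => i _.
rewrite -(cardC (mem (missed_vertices i))); congr (_ + _).
rewrite -sum1_card [RHS]big_mkcond; apply: eq_bigr => v _.
by rewrite [v \in predC _]inE /=; case: (_ \in _).
Qed.

Lemma third_edge v e f : e \in incident_edges v -> f \in incident_edges v ->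
  e != f -> exists g, incident_edges v = [set e; f; g] /\ g \notin [set e; f].
Proof.
move=> ev fv ef.
have sub : [set e; f] \subset incident_edges v.
  by apply/subsetP=> g /set2P[]->.
have : #|incident_edges v :\: [set e; f]| == 1.
  by rewrite cardsD (setIidPr sub) (G_cubic v) cards2 ef.
move=> /cards1P[g Dg]; exists g; split.
  by rewrite -(setID (incident_edges v) [set e; f]) (setIidPr sub) Dg.
by have := set11 g; rewrite -Dg => /setDP[].
Qed.

(* Otherwise the third edge would lie in all four cycles through [e] or [f]. *)
Lemma adjacent_edges_common_cycle v e f :
  e \in incident_edges v -> f \in incident_edges v -> e != f ->
  exists i, (e \in C i) && (f \in C i).
Proof.
move=> ev fv ef; apply/existsP; apply: contraT.
rewrite negb_exists => /forallP no.
have [g [Iv gef]] := third_edge _ _ _ ev fv ef.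
have : [set i | e \in C i] :|: [set i | f \in C i] \subset [set i | g \in C i].
  (* A cycle through just one of [e] and [f] that avoided [g] would have degree one at [v]. *)
  apply/subsetP => i; rewrite !inE => efi; have := C_even i v; rewrite Iv.
  case: (boolP (g \in C i)) => // gi.
  suff [h ->] : exists h, [set e; f; g] :&: C i = [set h] by rewrite cards1.
  have := no i; case/orP: efi => hi; rewrite hi ?andbT /= => /negPf ni;
    [exists e | exists f]; apply/setP=> h; rewrite !inE.
    have [->|_] := eqVneq h e; first by rewrite hi.
    have [->|_] := eqVneq h f; first by rewrite ni.
    by case: eqVneq => [->|] //=; rewrite (negPf gi).
  have [->|_] := eqVneq h f; first by rewrite hi orbT.
  have [->|_] := eqVneq h e; first by rewrite ni.
  by case: eqVneq => [->|] //=; rewrite (negPf gi).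
move=> /subset_leq_card; rewrite cardsU !C_double.
suff -> : [set i | e \in C i] :&: [set i | f \in C i] = set0 by rewrite cards0.
by apply/setP=> i; rewrite !inE (negPf (no i)).
Qed.

(* If both cycles avoided the same edge at [v], a third cycle through that edge
   would share another edge with both of them. *)
Lemma card_agree_cycles v i j : i != j -> v \notin missed_vertices i ->
  #|incident_edges v :&: [set e | (e \in C j) == (e \in C i)]| = 1.
Proof.
move=> ij vi.
have split3 k : #|incident_edges v :&: C k| + #|incident_edges v :\: C k| = 3.
  by rewrite cardsID (G_cubic v).
have ci := card_incident_cycle v i; rewrite vi in ci.
have /eqP/cards1P[d Dd] : #|incident_edges v :\: C i| = 1.
  by have := split3 i; rewrite ci => -[].
have [dv di] : d \in incident_edges v /\ d \notin C i.
  by have := set11 d; rewrite -Dd => /setDP[].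
have inDi e : e \in incident_edges v -> (e \in C i) = (e != d).
  move=> ev; rewrite -[RHS]/(~~ _) -(in_set1 e d) -Dd in_setD ev andbT.
  by rewrite negbK.
(* If [C j] misses [v], agreeing at [v] means avoiding [C i], which singles out [d]. *)
have [vj|vj] := boolP (v \in missed_vertices j).
  have -> : incident_edges v :&: [set e | (e \in C j) == (e \in C i)] = [set d].
    apply/setP=> e; rewrite -Dd !inE; move: vj; rewrite inE => /eqP/setP/(_ e).
    by rewrite !inE; case: (v \in ends e); case: (e \in C j); case: (e \in C i).
  by rewrite cards1.
have cj := card_incident_cycle v j; rewrite vj in cj.
have /eqP/cards1P[f Df] : #|incident_edges v :\: C j| = 1.
  by have := split3 j; rewrite cj => -[].
have [fv fj] : f \in incident_edges v /\ f \notin C j.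
  by have := set11 f; rewrite -Df => /setDP[].
have inDj e : e \in incident_edges v -> (e \in C j) = (e != f).
  move=> ev; rewrite -[RHS]/(~~ _) -(in_set1 e f) -Df in_setD ev andbT.
  by rewrite negbK.
have df : d != f.
  apply/eqP=> edf; rewrite -edf in fj inDj.
  have : 0 < #|[set i | d \in C i]| by rewrite C_double.
  case/card_gt0P=> k; rewrite inE => dk.
  have : 0 < #|(incident_edges v :&: C k) :\ d|.
    have := cardsD1 d (incident_edges v :&: C k).
    by rewrite (incident_cycle_eq2 _ _ _ dv dk) in_setI dv dk add1n => -[<-].
  case/card_gt0P=> e; rewrite in_setD1 => /andP[ed /setIP[ev ek]].
  apply: (in3_cycles e i j k) => //; rewrite ?inDi ?inDj //.
    by apply: contraNneq di => ->.
  by apply: contraNneq fj => ->.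
(* At [v], [C i] avoids only [d] and [C j] only [f], so they agree just on the third edge [g]. *)
have [g [Iv]] := third_edge _ _ _ dv fv df; rewrite !inE => /norP[gd gf].
suff -> : incident_edges v :&: [set e | (e \in C j) == (e \in C i)] = [set g].
  by rewrite cards1.
apply/setP=> e; rewrite in_setI in_set1 [e \in [set _ | _]]inE.
have [ev|ev] := boolP (e \in incident_edges v); last first.
  by apply/esym/negbTE; apply: contraNneq ev => ->; rewrite Iv !inE eqxx !orbT.
rewrite inDi // inDj //; move: ev; rewrite Iv !inE => /orP[/orP[]|] /eqP->.
- by rewrite eqxx df [RHS]eq_sym (negPf gd).
- by rewrite eqxx [f == d]eq_sym df [RHS]eq_sym (negPf gf).
- by rewrite gd gf !eqxx.
Qed.

(** * Perfect matchings of the expanded graph *)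

Section Matchings.
Variable i0 : 'I_n.
Let U := missed_vertices i0.

(* On original edges, agreeing with [C i0] means lying in the symmetric
   difference of [C j] and the complement of [C i0]. The triangle edge joining
   the ends of [e] and [f] belongs to [C i0] and to the cycle through both [e]
   and [f]. *)
Definition expanded_matching j : {set edge (expand U)} :=
  [set a : exp_edge U | match a with
    | inl e => (e \in C j) == (e \in C i0)
    | inr vP => (val vP).2 \subset C j
    end].

(** Outside [U] this is [card_agree_cycles]. At a new vertex [(v, e)], [C i0] avoids [e], so [e] is
    chosen exactly when [C j] avoids it too; otherwise [C j] uses two edges at [v], and the triangle
    edge for that pair is chosen instead. *)
Lemma expanded_matching_perfect j :
  i0 != j -> perfect_matching (expanded_matching j).
Proof.
move=> ij [[v vU]|[[v e] p]].
  rewrite -(card_agree_cycles v i0 j ij vU)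
    -(card_imset (f := inl : _ -> exp_edge U) _ (@inl_inj _ _)).
  apply: eq_card => a; apply/idP/imsetP.
    rewrite !inE; case: a => [e|vP]; rewrite /= ?inE //= => /andP[ve ej].
    by exists e; rewrite ?inE ?ve.
  by move=> [e + ->]; rewrite !inE.
have /andP[/= vU ve] := p.
have ev : e \in incident_edges v by rewrite inE.
have eN : e \in C i0 = false.
  move: vU; rewrite inE => /eqP/setP/(_ e).
  by rewrite in_setI ev in_set0.
have [ej|ej] := boolP (e \in C j); last first.
  apply/eqP/cards1P; exists (inl e); apply/setP => -[f|[[w P] q]];
    rewrite !inE /= ?inE /=.
    apply/idP/eqP => [/andP[/andP[_ /eqP->]]//|[->]].
    by rewrite ve eN (negPf ej) eqxx.
  apply/negP => /andP[/andP[_ eP] /subsetP/(_ _ eP)].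
  by rewrite (negPf ej).
have q : [&& v \in U, incident_edges v :&: C j \subset incident_edges v
           & #|incident_edges v :&: C j| == 2].
  by rewrite vU subsetIl (incident_cycle_eq2 _ _ _ ev ej).
apply/eqP/cards1P; exists (inr (Sub (v, incident_edges v :&: C j) q)).
apply/setP => -[f|[[w P] r]]; rewrite !inE /= ?inE /=.
  apply/negP => /andP[/andP[_ /eqP<-]].
  by rewrite ej eN.
apply/idP/eqP => [/andP[/andP[/eqP vw eP] Pj]|].
  congr inr; apply: val_inj => /=; rewrite -vw; congr pair.
  have /and3P[/= _ Pw /eqP P2] := r.
  apply/eqP; rewrite eqEcard (eqP (proj2 (andP (proj2 (andP q))))) P2 leqnn.
  by rewrite subsetI Pj vw Pw.
by move=> [-> ->]; rewrite eqxx subsetIr in_setI ev ej.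
Qed.

Lemma expanded_matching_cover (n_gt3 : 3 < n) (a : edge (expand U)) :
  exists2 j, i0 != j & a \in expanded_matching j.
Proof.
case: a => [e|[[v P] p]].
  have [e0|e0] := boolP (e \in C i0).
    have : 0 < #|[set i | e \in C i] :\ i0|.
      by have := cardsD1 i0 [set i | e \in C i]; rewrite C_double inE e0 add1n => -[<-].
    case/card_gt0P=> j; rewrite !inE => /andP[j0 ej]; exists j.
      by rewrite eq_sym.
    by rewrite inE ej e0.
  (* [i0] and the two cycles through [e] make three indices, so [3 < n] leaves another cycle
     avoiding [e], which agrees with [C i0] there. *)
  have : 0 < #|~: (i0 |: [set i | e \in C i])|.
    by rewrite cardsCs setCK cardsU1 C_double inE e0 card_ord subn_gt0.
  case/card_gt0P=> j; rewrite !inE => /norP[j0 ej]; exists j.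
    by rewrite eq_sym.
  by rewrite inE (negPf ej) (negPf e0).
have /and3P[/= vU Pv /cards2P[e [f [ef eP]]]] := p.
have [ev fv] : e \in incident_edges v /\ f \in incident_edges v.
  by split; apply: (subsetP Pv); rewrite eP !inE eqxx ?orbT.
have [j /andP[ej fj]] := adjacent_edges_common_cycle _ _ _ ev fv ef.
exists j; last first.
  by rewrite inE /= eP; apply/subsetP => h /set2P[]->.
(* The common cycle passes through [v], so it is not [C i0]. *)
apply: contraTneq vU => ij; rewrite /U ij inE.
by apply/set0Pn; exists e; rewrite in_setI ev ej.
Qed.

End Matchings.

End CycleDoubleCover.

(** * Five cycles: averaging, and existence of the minimum *)

Arguments missed_vertices {G n} C i.

Lemma covered_expand_missed (G : mgraph) (C : 'I_5 -> {set edge G}) (i0 : 'I_5) :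
  cubic G -> (forall i, even_subgraph (C i)) ->
  (forall e, #|[set i | e \in C i]| = 2) ->
  covered_by_4_perfect_matchings (expand (missed_vertices C i0)).
Proof.
move=> G_cubic C_even C_double.
(* [lift i0] enumerates the four indices other than [i0]. *)
exists (fun k => expanded_matching _ _ C i0 (lift i0 k)); split=> [k|].
  by apply: expanded_matching_perfect => //; apply: neq_lift.
apply/setP=> a; rewrite [RHS]inE; apply/bigcupP.
have [j ij aj] := expanded_matching_cover G 5 C G_cubic C_even C_double i0 isT a.
by have [k jk _] := unlift_some ij; exists k; rewrite // -jk.
Qed.

Lemma exists_small_missed_set (G : mgraph) (C : 'I_5 -> {set edge G}) :
  cubic G -> (forall i, even_subgraph (C i)) ->
  (forall e, #|[set i | e \in C i]| = 2) ->
  exists i, 5 * #|missed_vertices C i| <= 2 * #|vertex G|.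
Proof.
move=> G_cubic C_even C_double.
(* With five cycles the missed sets have total size 5|V| - 3|V| = 2|V|, and the smallest is at most
   the average. *)
have sumC := sum_missed_vertices G 5 C G_cubic C_even C_double.
have [i _ min_i] := arg_minnP (fun i => #|missed_vertices C i|) (erefl : xpredT ord0).
exists i; have : \sum_(k < 5) #|missed_vertices C i| <= \sum_k #|missed_vertices C k|.
  by apply: leq_sum => k _; apply: min_i.
by rewrite sum_nat_const card_ord; lia.
Qed.

(** A boolean form, so that [arg_minnP] can select a smallest admissible set. *)
Definition covered_by_4_perfect_matchingsb (G : mgraph) : bool :=
  [exists M : {ffun 'I_4 -> {set edge G}},
     [forall i, forall v, #|incident_edges v :&: M i| == 1]
     && (\bigcup_i M i == setT)].

Lemma covered_by_4_perfect_matchingsP (G : mgraph) :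
  reflect (covered_by_4_perfect_matchings G) (covered_by_4_perfect_matchingsb G).
Proof.
apply: (iffP existsP) => [[M /andP[/forallP pM /eqP cM]]|[M [pM cM]]].
  by exists M; split=> // i v; apply/eqP; apply: (forallP (pM i)).
exists (finfun M); apply/andP; split.
  by apply/forallP=> i; apply/forallP=> v; rewrite ffunE; apply/eqP/pM.
by apply/eqP; rewrite -cM; apply: eq_bigr => i _; rewrite ffunE.
Qed.

Lemma exists_is_T (G : mgraph) (U : {set vertex G}) :
  covered_by_4_perfect_matchings (expand U) ->
  exists2 t, is_T G t & t <= #|U|.
Proof.
move=> /covered_by_4_perfect_matchingsP covU.
have [W /covered_by_4_perfect_matchingsP covW minW] :=
  @arg_minnP _ U (fun W => covered_by_4_perfect_matchingsb (expand W))
    (fun W => #|W|) covU.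
exists #|W|; last exact: minW.
split; first by exists W.
by move=> X /covered_by_4_perfect_matchingsP; apply: minW.
Qed.

Local Close Scope nat_scope.

Theorem theorem3p3
  (five_cdc_conjecture : forall G : mgraph, bridgeless G -> has_5cdc G)
  (G : mgraph) (G_bridgeless : bridgeless G) (G_cubic : cubic G) :
  exists t : nat,
    is_T G t /\ (t%:R : rat) <= 2%:R / 5%:R * #|vertex G|%:R.
Proof.
have [C [C_even C_double]] := five_cdc_conjecture G G_bridgeless.
have [i small] := exists_small_missed_set G C G_cubic C_even C_double.
have [t tT le_t] :=
  exists_is_T G _ (covered_expand_missed G C i G_cubic C_even C_double).
exists t; split=> //.
(* Clearing the denominator 5 brings the bound back to natural numbers. *)
rewrite GRing.mulrAC Num.Theory.ler_pdivlMr ?Num.Theory.ltr0n //.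
rewrite -!GRing.natrM Num.Theory.ler_nat mulnC.
by apply: leq_trans small; rewrite leq_mul2l le_t.
Qed.
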